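(* Let $\mathcal{F}$ be a $C^1$-foliation of codimension $q$ on a closed manifold $M$. Let $\mathbf{E}_{\mathcal{R}}, \mathbf{P}_{\mathcal{R}}, \mathbf{H}_{\mathcal{R}} \subset \mathcal{T}$ be the sets of points of the complete transversal defined by \begin{itemize} \item (elliptic) $\mathbf{E}_{\mathcal{R}} = \{x \in \mathcal{T} \mid \sup_{\gamma \in \Gamma_{\mathcal{F}}^x} \max\{\|D\gamma\|, \|(D\gamma)^{-1}\|\} < \infty\}$; \item (parabolic) $\mathbf{P}_{\mathcal{R}} = \{x \in \mathcal{T} \setminus \mathbf{E}_{\mathcal{R}} \mid e(\Gamma_{\mathcal{F}},x) = 0\}$; \item (hyperbolic) $\mathbf{H}_{\mathcal{R}} = \{x \in \mathcal{T} \mid e(\Gamma_{\mathcal{F}},x) > 0\}$, \end{itemize} and let $\mathbf{E}_{\mathcal{F}}, \mathbf{P}_{\mathcal{F}}, \mathbf{H}_{\mathcal{F}} \subset M$ be the unions of the leaves meeting $\mathbf{E}_{\mathcal{R}}, \mathbf{P}_{\mathcal{R}}, \mathbf{H}_{\mathcal{R}}$ respectively. Then $\mathbf{E}_{\mathcal{R}}, \mathbf{P}_{\mathcal{R}}, \mathbf{H}_{\mathcal{R}}$ are saturated Borel subsets of $\mathcal{T}$, and $$M = \mathbf{E}_{\mathcal{F}} \cup \mathbf{P}_{\mathcal{F}} \cup \mathbf{H}_{\mathcal{F}}$$ is a decomposition of $M$ into pairwise disjoint, $\mathcal{F}$-saturated Borel subsets.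
   Context: Setting. $M$ is a closed manifold of dimension $n=p+q$ with a Riemannian metric, $\mathcal{F}$ a foliation of codimension $q$. Fix a finite cover of $M$ by foliation charts $\varphi_i : U_i \to (-1,1)^n$, $1\le i\le k$, each extending to a foliation chart $\tilde\varphi_i:\tilde U_i\to(-2,2)^n$ with $\overline{U_i}\subset \tilde U_i$ and $\tilde U_i$ convex; composing $\varphi_i$ with projection to the last $q$ coordinates gives a submersion whose fibers are the plaques (connected components of leaves of $\mathcal{F}|U_i$). Put $\mathcal{T}_i = \varphi_i^{-1}(\{0\}\times(-1,1)^q)$ and $\mathcal{T} = \bigsqcup_i \mathcal{T}_i$ (complete transversal), identified with a disjoint union of open cubes in $\mathbb{R}^q$. If $U_i\cap U_j\ne\emptyset$, let $h_{j,i}: \mathcal{T}_{i,j}\to \mathcal{T}_{j,i}$ be the transverse change of coordinates between open subsets $\mathcal{T}_{i,j}\subset\mathcal{T}_i$, $\mathcal{T}_{j,i}\subset\mathcal{T}_j$. $\mathcal{F}$ is $C^r$ if all $h_{j,i}$ are $C^r$. Let $\mathcal{G}_{\mathcal{F}}^{(1)}=\{h_{j,i}\}$; the holonomy pseudogroup $\mathcal{G}_{\mathcal{F}}$ consists of compositions of elements of $\mathcal{G}_{\mathcal{F}}^{(1)}$ and restrictions of these to open sets; $D(g)$ denotes the domain of $g$. Groupoid. $\Gamma_{\mathcal{F}}$ is the groupoid of germs $[g]_x$, $g\in\mathcal{G}_{\mathcal{F}}$, $x\in D(g)$, with source $x$ and range $g(x)$; $\Gamma_{\mathcal{F}}^x$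 is the set of germs with source $x$. For $\gamma=[g]_x$, $D\gamma = D_xg\in GL(q,\mathbb{R})$. The word length $\|\gamma\|_x$ is $0$ if $\gamma$ is the identity germ, and otherwise the least $m$ such that $\gamma=[g_{i_m}\circ\cdots\circ g_{i_1}]_x$ with each $g_{i_\ell}\in\mathcal{G}_{\mathcal{F}}^{(1)}$. For $x\in\mathcal{T}$, $L_x$ is the leaf through $x$. A subset $E\subset\mathcal{T}$ is saturated if $x\in E$ implies $L_x\cap\mathcal{T}\subset E$; a subset of $M$ is $\mathcal{F}$-saturated if it is a union of leaves. Transverse expansion. With $\|A\|$ the operator norm, $$e(\Gamma_{\mathcal{F}},\ell,x)=\max_{\gamma\in\Gamma_{\mathcal{F}}^x,\ \|\gamma\|_x\le \ell}\frac{\ln\max\{\|D\gamma\|,\|(D\gamma)^{-1}\|\}}{\ell},\qquad e(\Gamma_{\mathcal{F}},x)=\limsup_{\ell\to\infty}e(\Gamma_{\mathcal{F}},\ell,x)\ge0.$$ *)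

(* Defs.v *)
From HB Require Import structures.
From mathcomp Require Import all_boot all_order all_algebra.
From mathcomp Require Import all_classical all_reals all_analysis.

Set Implicit Arguments.
Unset Strict Implicit.
Unset Printing Implicit Defensive.

Import Order.TTheory GRing.Theory Num.Theory.
Import numFieldNormedType.Exports.

Local Open Scope classical_set_scope.
Local Open Scope ring_scope.

(** * Smooth manifolds and Riemannian distance *)

(* Meant for open [U]. *)
Fixpoint class_C (R : realType) (n : nat) (V : normedModType R) (r : nat)
    (U : set 'rV[R]_n) (f : 'rV[R]_n -> V) : Prop :=
  match r with
  | 0 => forall u, U u -> {for u, continuous f}
  | r'.+1 => (forall u, U u -> differentiable f u) /\
      forall i : 'I_n, class_C r' U (fun u => 'D_(delta_mx 0 i) f u)
  end.

Definition smooth (R : realType) (n : nat) (V : normedModType R)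
    (U : set 'rV[R]_n) (f : 'rV[R]_n -> V) : Prop :=
  forall r, class_C r U f.

(* Partial maps are total functions together with a set on which they are
   meaningful; their values elsewhere are irrelevant. *)
Record is_homeo (X Y : topologicalType) (U : set X) (V : set Y)
    (f : X -> Y) (g : Y -> X) : Prop := {
  homeo_open_dom : open U;
  homeo_open_img : open V;
  homeo_fun : forall x, U x -> V (f x);
  homeo_inv_fun : forall y, V y -> U (g y);
  homeo_funK : forall x, U x -> g (f x) = x;
  homeo_invK : forall y, V y -> f (g y) = y;
  homeo_cont : forall x, U x -> {for x, continuous f};
  homeo_inv_cont : forall y, V y -> {for y, continuous g} }.

Record smooth_atlas (R : realType) (n : nat) (M : topologicalType) := {
  chart_index : Type;
  chart_dom : chart_index -> set M;
  chart_img : chart_index -> set 'rV[R]_n;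
  chart_fun : chart_index -> M -> 'rV[R]_n;
  chart_inv : chart_index -> 'rV[R]_n -> M;
  chart_homeo : forall a,
    is_homeo (chart_dom a) (chart_img a) (chart_fun a) (chart_inv a);
  chart_cover : forall x, exists a, chart_dom a x;
  chart_smooth : forall a b,
    smooth (chart_fun a @` (chart_dom a `&` chart_dom b))
           (chart_fun b \o chart_inv a) }.

(* Tangent vectors are rows, so the Gram matrix in chart [a] is
   J * G_b * J^T, with J the Jacobian of the change of coordinates a -> b. *)
Record riemannian_metric (R : realType) (n : nat) (M : topologicalType)
    (A : smooth_atlas R n M) := {
  gram : chart_index A -> 'rV[R]_n -> 'M[R]_n;
  gram_smooth : forall a, smooth (chart_img a) (gram a);
  gram_sym : forall a u, chart_img a u -> (gram a u)^T = gram a u;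
  gram_pos : forall a u (v : 'rV[R]_n), chart_img a u -> v != 0 ->
    0 < (v *m gram a u *m v^T) 0 0;
  gram_change : forall a b x, chart_dom a x -> chart_dom b x ->
    let J := jacobian (chart_fun b \o chart_inv a) (chart_fun a x) in
    gram a (chart_fun a x) = J *m gram b (chart_fun b x) *m J^T }.

Section Riemannian.
Context (R : realType) (n : nat) (M : topologicalType).
Context (A : smooth_atlas R n M) (g : riemannian_metric A).

Definition C1_curve (c : R -> M) : Prop :=
  continuous c /\
  forall a t, chart_dom a (c t) ->
    derivable (chart_fun (s:=A) a \o c) t 1 /\
    {for t, continuous (derive1 (chart_fun (s:=A) a \o c))}.

Definition is_speed (c : R -> M) (s : R -> R) : Prop :=
  forall a t, chart_dom (s:=A) a (c t) ->
    let v := derive1 (chart_fun a \o c) t in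
    s t = Num.sqrt ((v *m gram g a (chart_fun a (c t)) *m v^T) 0 0).

(* Any C^1 curve on [0, 1] is, up to reparametrization, the restriction of a
   C^1 curve on the real line.  The value is +oo if and only if the two points
   lie in different components. *)
Definition riem_dist (x y : M) : \bar R :=
  ereal_inf [set (\int[lebesgue_measure]_(t in `[0%R, 1%R]) (s t)%:E)%E | s in
    [set s | exists c, [/\ C1_curve c, is_speed c s, c 0 = x & c 1 = y]]].

(* Minimizing geodesics, parametrized on [0, 1] proportionally to
   arc length. *)
Definition min_geodesic (x y : M) (c : R -> M) : Prop :=
  [/\ c 0 = x, c 1 = y, (riem_dist x y < +oo)%E &
    forall s t, 0 <= s <= 1 -> 0 <= t <= 1 ->
      riem_dist (c s) (c t) = (`|s - t|%:E * riem_dist x y)%E].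

Definition geod_convex (W : set M) : Prop :=
  forall x y, W x -> W y ->
    (exists2 c, min_geodesic x y c & forall t, 0 <= t <= 1 -> W (c t)) /\
    (forall c c', min_geodesic x y c -> min_geodesic x y c' ->
      forall t, 0 <= t <= 1 -> c t = c' t).

End Riemannian.

(** * Foliations *)

Definition cube (R : realType) (n : nat) (r : R) : set 'rV[R]_n :=
  [set v | forall i, `|v 0 i| < r].

(* [U] is open, [phi] is a homeomorphism from [U] to (-r, r)^(p+q) with inverse
   [psi], and the connected components of the traces of the leaves on [U], the
   plaques, are the fibres of the projection to the last q coordinates. *)
Record is_foliation_chart (R : realType) (p q : nat) (M : topologicalType)
    (leaf : M -> set M) (r : R) (U : set M)
    (phi : M -> 'rV[R]_(p + q)) (psi : 'rV[R]_(p + q) -> M) : Prop := {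
  fol_chart_homeo : is_homeo U (cube r) phi psi;
  fol_chart_plaque : forall x, U x ->
    connected_component (leaf x `&` U) x =
    [set y | U y /\ rsubmx (phi y) = rsubmx (phi x)] }.

(* Leaves are required to be path connected in the topology of [M], not merely
   connected: the union of two dense leaves is connected.  Since the components
   of the trace of a leaf on a chart are the plaques, a path in a leaf runs
   locally in a plaque, so this is connectedness for the leaf topology. *)
Record foliation (R : realType) (p q : nat) (M : topologicalType) := {
  leaf : M -> set M;
  leaf_refl : forall x, leaf x x;
  leaf_eq : forall x y, leaf x y -> leaf y = leaf x;
  leaf_path_connected : forall x y, leaf x y ->
    exists c : R -> M, [/\ continuous c, c 0 = x, c 1 = y &
      forall t, 0 <= t <= 1 -> leaf x (c t)];
  foliation_charts : forall x, exists (U : set M)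
    (phi : M -> 'rV[R]_(p + q)) (psi : 'rV[R]_(p + q) -> M),
    U x /\ is_foliation_chart leaf 1 U phi psi }.

(* [trans_change j i] is the change of transverse coordinates h_{j,i}. *)
Record foliation_cover (R : realType) (p q : nat) (M : topologicalType)
    (A : smooth_atlas R (p + q) M) (g : riemannian_metric A)
    (F : foliation R p q M) (k : nat) := {
  fc_big : 'I_k -> set M;
  fc_dom : 'I_k -> set M;
  fc_phi : 'I_k -> M -> 'rV[R]_(p + q);
  fc_psi : 'I_k -> 'rV[R]_(p + q) -> M;
  fc_big_chart : forall i,
    is_foliation_chart (leaf F) 2 (fc_big i) (fc_phi i) (fc_psi i);
  fc_dom_chart : forall i,
    is_foliation_chart (leaf F) 1 (fc_dom i) (fc_phi i) (fc_psi i);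
  fc_closure : forall i, closure (fc_dom i) `<=` fc_big i;
  fc_convex : forall i, geod_convex g (fc_big i);
  fc_covers : forall x, exists i, fc_dom i x;
  trans_change : 'I_k -> 'I_k -> 'rV[R]_q -> 'rV[R]_q;
  trans_changeP : forall i j x, fc_dom i x -> fc_dom j x ->
    trans_change j i (rsubmx (fc_phi i x)) = rsubmx (fc_phi j x) }.

(** * Partial maps and germs *)

Record pmap (X : Type) := PMap { pdom : set X; pfun :> X -> X }.

Definition pcomp (X : Type) (g f : pmap X) : pmap X :=
  PMap (pdom f `&` f @^-1` pdom g) (g \o f).

Definition prestr (X : Type) (g : pmap X) (V : set X) : pmap X :=
  PMap (pdom g `&` V) g.

(* Germs at [x] are represented as equivalence classes of functions. *)
Definition germ (X : topologicalType) (x : X) (f : X -> X) : set (X -> X) :=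
  [set f' | \forall y \near x, f y = f' y].

Definition borel_subset (X : topologicalType) (D : set X) : set (set X) :=
  <<s D, [set D `&` V | V in [set V : set X | open V]] >>.

Definition eucl_norm (R : realType) (q : nat) (v : 'rV[R]_q) : R :=
  Num.sqrt (\sum_i v 0 i ^+ 2).

Definition op_norm (R : realType) (q : nat) (B : 'M[R]_q) : R :=
  sup [set eucl_norm (v *m B) | v in [set v : 'rV[R]_q | eucl_norm v <= 1]].

(* The disjoint union of k copies of R^q. *)
Definition copies (R : realType) (q k : nat) : topologicalType :=
  {i : 'I_k & (fun=> 'rV[R]_q : topologicalType) i}.

Definition copy (R : realType) (q k : nat) (i : 'I_k) (u : 'rV[R]_q) :
    copies R q k :=
  existT (fun _ : 'I_k => ('rV[R]_q : topologicalType) : Type) i u.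

(* The transverse derivative D_x f, as a matrix acting on rows. *)
Definition trans_deriv (R : realType) (q k : nat)
    (f : copies R q k -> copies R q k) (x : copies R q k) : 'M[R]_q :=
  jacobian (fun u : 'rV[R]_q => projT2 (f (copy (projT1 x) u)) : 'rV[R]_q)
           (projT2 x).

(** * The transverse dynamics of a foliation *)

Section Holonomy.
Context (R : realType) (p q : nat) (M : topologicalType).
Context (A : smooth_atlas R (p + q) M) (g : riemannian_metric A).
Context (F : foliation R p q M) (k : nat) (C : foliation_cover g F k).

Definition overlap (i j : 'I_k) : Prop := fc_dom C i `&` fc_dom C j !=set0.

(* The domain T_{i,j} of h_{j,i}. *)
Definition trans_dom (i j : 'I_k) : set 'rV[R]_q :=
  [set rsubmx (fc_phi C i x) | x in fc_dom C i `&` fc_dom C j].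

Definition foliation_C (r : nat) : Prop :=
  forall i j, overlap i j -> class_C r (trans_dom i j) (trans_change C j i).

(* The complete transversal, identified with a disjoint union of cubes;
   [trans_pt] is the identification with the points of M. *)
Definition complete_transversal : set (copies R q k) :=
  [set x | cube 1 (projT2 x)].

Definition trans_pt (x : copies R q k) : M :=
  fc_psi C (projT1 x) (row_mx 0 (projT2 x)).

Definition hol_gen (i j : 'I_k) : pmap (copies R q k) :=
  PMap (@copy R q k i @` trans_dom i j)
       (fun x => copy j (trans_change C j i (projT2 x))).

Definition hol_gens : set (pmap (copies R q k)) :=
  [set h | exists i j, overlap i j /\ h = hol_gen i j].

Inductive holonomy : pmap (copies R q k) -> Prop :=
| holonomy_gen h : hol_gens h -> holonomy h
| holonomy_comp h f : holonomy h -> holonomy f -> holonomy (pcomp h f)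
| holonomy_restr h V : holonomy h -> open V -> holonomy (prestr h V).

Local Notation germ_type := (set (copies R q k -> copies R q k)).

Definition germs_at (x : copies R q k) : set germ_type :=
  [set germ x (pfun h) | h in [set h | holonomy h /\ pdom h x]].

Fixpoint hol_words (m : nat) : set (pmap (copies R q k)) :=
  match m with
  | 0 => [set PMap complete_transversal id]
  | m'.+1 => [set pcomp h f | h in hol_gens & f in hol_words m']
  end.

(* The empty word is the identity, so that identity germs have length 0. *)
Definition is_word_germ (x : copies R q k) (gam : germ_type) (m : nat) : Prop :=
  exists h, [/\ hol_words m h, pdom h x & gam = germ x (pfun h)].

Definition word_length (x : copies R q k) (gam : germ_type) : nat :=
  xget 0%N [set m | is_word_germ x gam m /\
    forall m', is_word_germ x gam m' -> (m <= m')%N].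

(* [xget] picks a representative of the germ. *)
Definition germ_deriv (x : copies R q k) (gam : germ_type) : 'M[R]_q :=
  trans_deriv (xget (@id (copies R q k)) gam) x.

Definition distortion (x : copies R q k) (gam : germ_type) : R :=
  Num.max (op_norm (germ_deriv x gam)) (op_norm (invmx (germ_deriv x gam))).

Definition expansion_at (l : nat) (x : copies R q k) : \bar R :=
  ereal_sup [set (ln (distortion x gam) / l%:R)%:E |
    gam in [set gam | germs_at x gam /\ (word_length x gam <= l)%N]].

Definition expansion (x : copies R q k) : \bar R :=
  limn_esup (fun l => expansion_at l x).

Definition elliptic : set (copies R q k) :=
  [set x | complete_transversal x /\
    (ereal_sup [set (distortion x gam)%:E | gam in germs_at x] < +oo)%E].

Definition parabolic : set (copies R q k) :=
  [set x | (complete_transversal `\` elliptic) x /\ expansion x = 0%E].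

Definition hyperbolic : set (copies R q k) :=
  [set x | complete_transversal x /\ (0 < expansion x)%E].

Definition trans_saturated (E : set (copies R q k)) : Prop :=
  forall x y, E x -> complete_transversal y ->
    leaf F (trans_pt x) (trans_pt y) -> E y.

Definition leaves_meeting (E : set (copies R q k)) : set M :=
  \bigcup_(L in [set L | (exists x, L = leaf F x) /\
                         exists2 y, E y & L (trans_pt y)]) L.

Definition fol_saturated (B : set M) : Prop :=
  exists S : set M, B = \bigcup_(x in S) leaf F x.

End Holonomy.

(* Main.v *)
Require Import Defs.
From HB Require Import structures.
From mathcomp Require Import all_boot all_order all_algebra.
From mathcomp Require Import all_classical all_reals all_analysis.
From mathcomp Require Import lra.

(** Every germ at a point [x] of the transversal is the germ of a word in the
    generators h_{j,i}, and there are countably many words.  The derivative of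
    a word and its inverse are continuous on its open domain, so for each word
    [s] and real [a] the points of the domain of [s] at which the distortion of
    [s] exceeds [a] form an open set.  Boundedness of the distortion, and
    vanishing of the expansion rate, are countable Boolean combinations of
    these conditions, hence Borel.

    A path in a leaf crosses finitely many plaques, so two points of the
    transversal on the same leaf are related by a word [s]; right composition
    with [s] changes lengths by at most a constant and distortions by at most a
    constant factor, hence the three sets are saturated.  Since a bounded
    distortion forces a zero rate, they partition the transversal.  Finally, in
    a chart U_i a set of leaves is the preimage of its trace on the transversal
    under the projection of U_i to T_i, which transfers the partition and
    Borel measurability to M. *)

Set Implicit Arguments.
Unset Strict Implicit.
Unset Printing Implicit Defensive.

Import Order.TTheory GRing.Theory Num.Theory.
Import numFieldNormedType.Exports.

Local Open Scope classical_set_scope.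
Local Open Scope ring_scope.

Lemma invmxM (F : comUnitRingType) n (A B : 'M[F]_n) :
  A \in unitmx -> B \in unitmx -> invmx (A *m B) = invmx B *m invmx A.
Proof.
move=> uA uB; have uAB : A *m B \in unitmx by rewrite unitmx_mul uA.
by rewrite -[RHS](mulKmx uAB) -(mulmxA A) mulKVmx// mulmxV// mulmx1.
Qed.

(** * Operator norm and distortion of matrices *)

Section OperatorNorm.
Context {R : realType}.

Lemma eucl_norm_ge0 q (v : 'rV[R]_q) : 0 <= eucl_norm v.
Proof. exact: sqrtr_ge0. Qed.

Lemma eucl_normZ q (a : R) (v : 'rV[R]_q) :
  eucl_norm (a *: v) = `|a| * eucl_norm v.
Proof.
rewrite /eucl_norm -sqrtr_sqr -sqrtrM ?sqr_ge0// mulr_sumr.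
by congr Num.sqrt; apply: eq_bigr => i _; rewrite mxE exprMn.
Qed.

Lemma eucl_norm0 q : eucl_norm (0 : 'rV[R]_q) = 0.
Proof. by rewrite -(scale0r (0 : 'rV[R]_q)) eucl_normZ normr0 mul0r. Qed.

Lemma ler_coord_eucl_norm q (v : 'rV[R]_q) i : `|v 0 i| <= eucl_norm v.
Proof.
rewrite -sqrtr_sqr ler_wsqrtr// (bigD1 i)//= lerDl.
by apply: sumr_ge0 => j _; exact: sqr_ge0.
Qed.

Lemma eucl_norm_eq0 q (v : 'rV[R]_q) : eucl_norm v = 0 -> v = 0.
Proof.
move=> v0; apply/rowP => i; rewrite mxE; apply/eqP; rewrite -normr_le0.
by rewrite -v0 ler_coord_eucl_norm.
Qed.

Lemma op_norm_has_ubound q (B : 'M[R]_q) :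
  has_ubound [set eucl_norm (v *m B) | v in [set v : 'rV[R]_q | eucl_norm v <= 1]].
Proof.
(* On the unit ball each coordinate of [v] is at most 1 in absolute value, so column [j] contributes
   at most the sum of the [|B i j|]. *)
exists (Num.sqrt (\sum_j (\sum_i `|B i j|) ^+ 2)) => _ [v /= v1 <-].
rewrite ler_wsqrtr//; apply: ler_sum => j _.
rewrite -real_normK ?num_real// lerXn2r ?nnegrE ?sumr_ge0//.
rewrite mxE (le_trans (ler_norm_sum _ _ _))//; apply: ler_sum => i _.
by rewrite normrM ler_piMl// (le_trans _ v1)// ler_coord_eucl_norm.
Qed.

Lemma op_norm_gtP q (B : 'M[R]_q) a :
  a < op_norm B <-> exists2 v, eucl_norm v <= 1 & a < eucl_norm (v *m B).
Proof.
split=> [/sup_gt[]|[v v1 aB]].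
- by exists (eucl_norm (0 *m B)); exists 0 => //=; rewrite eucl_norm0.
- by move=> _ [v v1 <-]; exists v.
- by apply: (lt_le_trans aB); apply: (ub_le_sup (op_norm_has_ubound B)); exists v.
Qed.

Lemma op_norm_ge0 q (B : 'M[R]_q) : 0 <= op_norm B.
Proof.
apply: (le_trans (eucl_norm_ge0 (0 *m B))).
by apply: (ub_le_sup (op_norm_has_ubound B)); exists 0; rewrite //= eucl_norm0.
Qed.

Lemma eucl_norm_mulmx q (B : 'M[R]_q) v :
  eucl_norm (v *m B) <= op_norm B * eucl_norm v.
Proof.
have [/eucl_norm_eq0 ->|v0] := eqVneq (eucl_norm v) 0.
  by rewrite mul0mx eucl_norm0 mulr0.
rewrite -ler_pdivrMr ?lt_neqAle 1?eq_sym ?v0 ?eucl_norm_ge0//.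
apply: (ub_le_sup (op_norm_has_ubound B)); exists ((eucl_norm v)^-1 *: v).
  by rewrite /= eucl_normZ ger0_norm ?invr_ge0 ?eucl_norm_ge0// mulVf.
by rewrite -scalemxAl eucl_normZ ger0_norm ?invr_ge0 ?eucl_norm_ge0// mulrC.
Qed.

Lemma op_norm_le q (B : 'M[R]_q) a :
  (forall v, eucl_norm v <= 1 -> eucl_norm (v *m B) <= a) -> op_norm B <= a.
Proof.
move=> Ba; rewrite leNgt; apply/negP => /op_norm_gtP[v /Ba].
by rewrite leNgt => /negP.
Qed.

Lemma op_normM q (A B : 'M[R]_q) : op_norm (A *m B) <= op_norm A * op_norm B.
Proof.
apply: op_norm_le => v v1; rewrite mulmxA (le_trans (eucl_norm_mulmx _ _))//.
rewrite mulrC ler_wpM2r ?op_norm_ge0// (le_trans (eucl_norm_mulmx _ _))//.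
by rewrite ler_piMr ?op_norm_ge0.
Qed.

Definition mx_distortion q (B : 'M[R]_q) : R :=
  Num.max (op_norm B) (op_norm (invmx B)).

Lemma mx_distortion_ge0 q (B : 'M[R]_q) : 0 <= mx_distortion B.
Proof. by rewrite le_max op_norm_ge0. Qed.

Lemma lt_mx_distortion q (B : 'M[R]_q) a :
  (a < mx_distortion B) = (a < op_norm B) || (a < op_norm (invmx B)).
Proof. by rewrite /mx_distortion lt_max. Qed.

(** Submultiplicativity of the norm, applied to the product and to its inverse; invertibility is
    what makes [invmx] reverse the product. *)
Lemma mx_distortionM q (A B : 'M[R]_q) : A \in unitmx -> B \in unitmx ->
  mx_distortion (A *m B) <= mx_distortion A * mx_distortion B.
Proof.
move=> uA uB; rewrite {1}/mx_distortion ge_max; apply/andP; split.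
  by rewrite (le_trans (op_normM _ _))// ler_pM ?op_norm_ge0// le_max lexx.
rewrite invmxM// (le_trans (op_normM _ _))// mulrC.
by rewrite ler_pM ?op_norm_ge0// le_max lexx orbT.
Qed.

Lemma mx_distortionV q (A : 'M[R]_q) : mx_distortion (invmx A) = mx_distortion A.
Proof. by rewrite /mx_distortion invmxK maxC. Qed.

End OperatorNorm.

(** * Continuity of matrix-valued maps *)

Section MatrixContinuity.
Context {R : realType} {X : topologicalType}.

Definition mx_continuous_at m n (J : X -> 'M[R]_(m, n)) (x : X) : Prop :=
  forall i j, {for x, continuous (fun y => J y i j)}.

Lemma near_eq_mx_continuous_at m n (J K : X -> 'M[R]_(m, n)) x :
  (\forall y \near x, J y = K y) -> mx_continuous_at J x -> mx_continuous_at K x.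
Proof.
move=> JK cJ i j; rewrite /prop_for /continuous_at -(nbhs_singleton JK).
apply: cvg_trans (cJ i j); apply: near_eq_cvg.
by move: JK; apply: filterS => y ->.
Qed.

Lemma mx_continuous_at_comp (Y : topologicalType) m n (f : X -> Y)
    (J : Y -> 'M[R]_(m, n)) x :
  {for x, continuous f} -> (forall i j, {for f x, continuous (fun y => J y i j)}) ->
  mx_continuous_at (J \o f) x.
Proof. by move=> cf cJ i j; apply: (continuous_comp cf (cJ i j)). Qed.

Lemma mx_continuous_atM m n p (J : X -> 'M[R]_(m, n)) (K : X -> 'M[R]_(n, p)) x :
  mx_continuous_at J x -> mx_continuous_at K x ->
  mx_continuous_at (fun y => J y *m K y) x.
Proof.
move=> cJ cK i j.
have -> : (fun y => (J y *m K y) i j) = (fun y => \sum_k J y i k * K y k j).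
  by apply/funext => y; rewrite mxE.
rewrite /continuous_at.
apply: cvg_big => [|k _]; first exact: add_continuous.
by apply: cvgM; [exact: cJ|exact: cK].
Qed.

Lemma eucl_norm_continuous_at q (J : X -> 'rV[R]_q) x :
  mx_continuous_at J x -> {for x, continuous (fun y => eucl_norm (J y))}.
Proof.
move=> cJ; rewrite /eucl_norm; apply: continuous_comp; last exact: sqrt_continuous.
apply: cvg_big => [|k _]; first exact: add_continuous.
by apply: cvgM; exact: cJ.
Qed.

(* Only semicontinuity of the operator norm, a supremum of continuous
   functions, is needed. *)
Lemma near_op_norm_gt q (J : X -> 'M[R]_q) x a :
  mx_continuous_at J x -> a < op_norm (J x) -> \forall y \near x, a < op_norm (J y).
Proof.
move=> cJ /op_norm_gtP[v v1 av].
have cv : {for x, continuous (fun y => eucl_norm (v *m J y))}.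
  apply: eucl_norm_continuous_at; apply: (mx_continuous_atM (J := cst v)) => //.
  by move=> i j; exact: cst_continuous.
have : \forall y \near x, a < eucl_norm (v *m J y) by exact: (cvgr_gt _ cv).
by apply: filterS => y ay; apply/op_norm_gtP; exists v.
Qed.

End MatrixContinuity.

(** * Differentials of locally equal maps and the chain rule for jacobians *)

Section LocalDiff.
Context {R : numFieldType} {V W : normedModType R}.
Implicit Types f g : V -> W.

Lemma near_eq_differentiable f g (x : V) : (\forall y \near x, f y = g y) ->
  differentiable f x -> differentiable g x /\ 'd g x = 'd f x :> (V -> W).
Proof.
move=> fg /diff_locallyP[cd fd].
(* The first-order expansion of [f] at [x] is also one of [g], since the two agree near [x];
   uniqueness of the differential then gives the claim. *)
have {}fd : g \o shift x = cst (g x) + 'd f x +o_ (0 : V) id.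
  apply/eqaddoP => e e0; move/eqaddoP : fd => /(_ e e0).
  have : \forall h \near (0 : V), f (h + x) = g (h + x).
    by move: fg; rewrite (near_shift (0 : V) x) subr0.
  apply: filterS2 => h fgh; congr (_ <= _).
  by rewrite -[LHS]/(`|f (h + x) - (f x + 'd f x h)|) fgh (nbhs_singleton fg).
have dgf := diff_unique cd fd; split => //.
by apply/diff_locallyP; rewrite dgf.
Qed.

End LocalDiff.

Lemma jacobian_id (R : numFieldType) n (x : 'rV[R]_n) :
  'J (fun u => u) x = 1%:M.
Proof.
apply/row_matrixP => i; rewrite !rowE mulmx1 /jacobian mul_rV_lin1.
have E : 'd (fun u : 'rV[R]_n => u) x = id :> ('rV[R]_n -> 'rV[R]_n).
  exact: diff_val.
exact: (congr1 (fun d => d (delta_mx 0 i)) E).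
Qed.

(** Jacobians act on rows from the right, so the factor of the inner map comes first. *)
Lemma jacobian_comp (R : numFieldType) m n p (f : 'rV[R]_m -> 'rV[R]_n)
    (h : 'rV[R]_n -> 'rV[R]_p) x :
  differentiable f x -> differentiable h (f x) ->
  'J (h \o f) x = 'J f x *m 'J h (f x).
Proof.
move=> df dh; apply/row_matrixP => i; rewrite row_mul !rowE.
rewrite -!deriveEjacobian//; last exact: differentiable_comp.
by rewrite !deriveE//; [rewrite diff_comp|exact: differentiable_comp].
Qed.

(** * Borel subsets of a subspace *)

Section BorelSubsets.
Context {X : topologicalType}.
Implicit Types D V : set X.

Lemma eq_borel D A B : (forall x, A x <-> B x) ->
  borel_subset D A -> borel_subset D B.
Proof. by move=> AB; rewrite (_ : A = B)//; apply/seteqP; split=> x /AB. Qed.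

Lemma borel_open D V : open V -> borel_subset D [set x | D x /\ V x].
Proof. by move=> oV; apply: sub_sigma_algebra; exists V. Qed.

Lemma borel_not D (P : X -> Prop) : borel_subset D [set x | D x /\ P x] ->
  borel_subset D [set x | D x /\ ~ P x].
Proof.
move=> /sigma_algebraCD bP; apply: eq_borel bP => x.
by split=> -[Dx nP]; split => //; [move=> Px; apply: nP|case].
Qed.

Lemma borel_exists (I : countType) D (P : I -> X -> Prop) :
  (forall i, borel_subset D [set x | D x /\ P i x]) ->
  borel_subset D [set x | D x /\ exists i, P i x].
Proof.
move=> bP.
pose A n := if unpickle n is Some i then [set x | D x /\ P i x] else set0.
have -> : [set x | D x /\ exists i, P i x] = \bigcup_n A n.
  apply/seteqP; split=> [x [Dx [i Px]]|x [n _]]; last first.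
    by rewrite /A; case: unpickle => //= i [Dx Px]; split => //; exists i.
  by exists (pickle i) => //; rewrite /A pickleK.
apply: sigma_algebra_bigcup => n; rewrite /A.
by case: unpickle => [i|]; [exact: bP|exact: sigma_algebra0].
Qed.

Lemma borel_forall (I : countType) D (P : I -> X -> Prop) :
  (forall i, borel_subset D [set x | D x /\ P i x]) ->
  borel_subset D [set x | D x /\ forall i, P i x].
Proof.
move=> bP.
apply: eq_borel (borel_not (borel_exists (fun i => borel_not (bP i)))) => x.
split=> -[Dx Px]; split => //; last by case.
by move=> i; apply: contrapT => nP; apply: Px; exists i.
Qed.

Lemma borel_and D (P Q : X -> Prop) :
  borel_subset D [set x | D x /\ P x] -> borel_subset D [set x | D x /\ Q x] ->
  borel_subset D [set x | D x /\ (P x /\ Q x)].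
Proof.
move=> bP bQ.
have bPQ b : borel_subset D [set x | D x /\ if b then P x else Q x] by case: b.
apply: eq_borel (borel_forall bPQ) => x.
split=> -[Dx PQ]; split => //; last by case; case: PQ.
by split; [exact: PQ true|exact: PQ false].
Qed.

(** Serves for the side conditions on lengths in [slow_dist], which do not depend on the point. *)
Lemma borel_imply_cst D (p : Prop) (P : X -> Prop) :
  (p -> borel_subset D [set x | D x /\ P x]) ->
  borel_subset D [set x | D x /\ (p -> P x)].
Proof.
have [pT /(_ pT) bP|np _] := pselect p.
  by apply: eq_borel bP => x; split=> -[Dx Px]; split => //; apply: Px.
by apply: eq_borel (borel_open openT) => x; split=> -[Dx].
Qed.

End BorelSubsets.

Lemma borel_preimage (X Y : topologicalType) (D : set X) (U : set Y) (f : Y -> X) B :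
  open U -> (forall y, U y -> D (f y)) ->
  (forall y, U y -> {for y, continuous f}) ->
  borel_subset D B -> borel_subset [set: Y] (U `&` f @^-1` B).
Proof.
move=> oU UD cf.
have openU (V : set Y) : open V -> borel_subset [set: Y] V.
  by move=> /(borel_open (D := setT)) bV; apply: eq_borel bV => x; split=> // -[].
(* The sets with Borel preimage form a sigma-algebra on [D] containing the relatively open sets. For
   complements, [f] mapping [U] into [D] is used. *)
pose S := [set B | borel_subset [set: Y] (U `&` f @^-1` B)].
suff: borel_subset D `<=` S by apply.
apply: smallest_sub => [|_ [V oV <-]]; last first.
  apply: openU; rewrite (_ : _ `&` _ = U `&` f @^-1` V); last first.
    by apply/seteqP; split=> y [Uy]; [case|move=> Vy]; split => //; split => //; exact: UD.
  rewrite openE => y [Uy Vfy]; apply: filterI; first exact: open_nbhs_nbhs.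
  by apply: (cf y Uy); exact: open_nbhs_nbhs.
split=> [|A bA|A bA].
- by rewrite /S /= preimage_set0 setI0; exact: sigma_algebra0.
- have bU := borel_open (D := setT) oU.
  have bUA : borel_subset setT [set y | [set: Y] y /\ (U `&` f @^-1` A) y].
    by apply: eq_borel bA => y; split=> // -[].
  apply: eq_borel (borel_and bU (borel_not bUA)) => y; split.
    by move=> [_ [Uy nA]]; do 2?[split => //]; [exact: UD|move=> Ay; apply: nA].
  by move=> [Uy [_ nA]]; split => //; split => // -[].
- rewrite /S /= preimage_bigcup setI_bigcupr; exact: sigma_algebra_bigcup.
Qed.

(** * Local diffeomorphisms of a disjoint union of copies of R^q *)

Section Copies.
Context {R : realType} {q k : nat}.
Local Notation X := (copies R q k).
Implicit Types (x y : X) (f h : X -> X).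

Lemma copy_projK x : copy (projT1 x) (projT2 x) = x.
Proof. by case: x. Qed.

Lemma near_copy x (P : X -> Prop) : (\forall y \near x, P y) <->
  \forall u \near (projT2 x : 'rV[R]_q), P (copy (projT1 x) u).
Proof. by case: x. Qed.

Lemma near_projT1 x : \forall y \near x, projT1 y = projT1 x.
Proof. by apply/near_copy; apply: filterE. Qed.

Lemma continuous_projT2 x : {for x, continuous (fun y : X => projT2 y : 'rV[R]_q)}.
Proof. by case: x => i u A /= uA; apply/(near_copy (copy i u)). Qed.

(** The copy in which [f] lands is forgotten; for [f] continuous at [x] it is the same for all
    points near [x]. *)
Definition in_coord f x : 'rV[R]_q -> 'rV[R]_q :=
  fun u => projT2 (f (copy (projT1 x) u)).

Lemma near_eq_in_coord f h x : (\forall y \near x, f y = h y) ->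
  \forall u \near (projT2 x : 'rV[R]_q), in_coord f x u = in_coord h x u.
Proof. by move/near_copy; apply: filterS => u fh; rewrite /in_coord fh. Qed.

(** Makes the derivative of a germ independent of the representative chosen. *)
Lemma near_eq_trans_deriv f h x : differentiable (in_coord f x) (projT2 x) ->
  (\forall y \near x, f y = h y) -> trans_deriv h x = trans_deriv f x.
Proof.
move=> df /near_eq_in_coord fh; have [_ dhf] := near_eq_differentiable fh df.
exact: (congr1 (@lin1_mx R q q) dhf).
Qed.

(** By continuity [f] stays near [x] in the copy of [f x], which is the copy in which [h] is read on
    the left-hand side. *)
Lemma near_in_coord_comp f h x : {for x, continuous f} ->
  \forall u \near (projT2 x : 'rV[R]_q),
    (in_coord h (f x) \o in_coord f x) u = in_coord (h \o f) x u.
Proof.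
move=> cf; have : \forall y \near x, projT1 (f y) = projT1 (f x).
  exact: cf _ (near_projT1 (f x)).
move=> /near_copy; apply: filterS => u fu.
by rewrite /in_coord /= -fu copy_projK.
Qed.

(** Continuity of the inverse derivative is a separate field: it passes to composites through
    products, and for a generator h_{j,i} it comes from the derivative of h_{i,j}, so that
    continuity of matrix inversion is never invoked. *)
Record local_C1_diffeo (D : set X) f : Prop := {
  C1_open : open D;
  C1_continuous : forall x, D x -> {for x, continuous f};
  C1_differentiable : forall x, D x -> differentiable (in_coord f x) (projT2 x);
  C1_unit : forall x, D x -> trans_deriv f x \in unitmx;
  C1_deriv : forall x, D x -> mx_continuous_at (trans_deriv f) x;
  C1_deriv_inv : forall x, D x ->
    mx_continuous_at (fun y => invmx (trans_deriv f y)) x }.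

Lemma differentiable_in_coord_comp f h x : {for x, continuous f} ->
  differentiable (in_coord f x) (projT2 x) ->
  differentiable (in_coord h (f x)) (projT2 (f x)) ->
  differentiable (in_coord (h \o f) x) (projT2 x) /\
  trans_deriv (h \o f) x = trans_deriv f x *m trans_deriv h (f x).
Proof.
move=> cf df dh.
have fxE : in_coord f x (projT2 x) = projT2 (f x).
  by rewrite /in_coord copy_projK.
have dh' : differentiable (in_coord h (f x)) (in_coord f x (projT2 x)).
  by rewrite fxE.
have [dhf E] := near_eq_differentiable (near_in_coord_comp h cf)
  (differentiable_comp df dh').
split; first exact: dhf.
apply: (etrans (congr1 (@lin1_mx R q q) E)).
by rewrite [LHS](jacobian_comp df dh') fxE.
Qed.

End Copies.

Section LocalDiffeo.
Context {R : realType} {q k : nat}.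
Local Notation X := (copies R q k).
Implicit Types (x y : X) (f h : X -> X) (D E : set X).

Lemma local_C1_diffeo_comp D E f h : local_C1_diffeo D f ->
  local_C1_diffeo E h -> local_C1_diffeo (D `&` f @^-1` E) (h \o f).
Proof.
move=> Cf Ch; set DE := _ `&` _.
have oDE : open DE.
  rewrite openE => x [Dx Efx]; apply: filterI.
    by apply: open_nbhs_nbhs; split => //; exact: C1_open Cf.
  apply: (C1_continuous Cf Dx); apply: open_nbhs_nbhs; split => //.
  exact: C1_open Ch.
have chain x : DE x -> differentiable (in_coord (h \o f) x) (projT2 x) /\
    trans_deriv (h \o f) x = trans_deriv f x *m trans_deriv h (f x).
  move=> [Dx Ex]; apply: differentiable_in_coord_comp.
  - exact: C1_continuous Cf _ Dx.
  - exact: C1_differentiable Cf _ Dx.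
  - exact: C1_differentiable Ch _ Ex.
have near_DE x : DE x -> \forall y \near x, DE y.
  by move=> DEx; exact: open_nbhs_nbhs.
split => // x DEx; have [Dx Ex] := DEx.
- exact: continuous_comp (C1_continuous Cf Dx) (C1_continuous Ch Ex).
- exact: (chain x DEx).1.
- rewrite [trans_deriv _ _](chain x DEx).2 unitmx_mul.
  by apply/andP; split; [exact: C1_unit Cf _ Dx|exact: C1_unit Ch _ Ex].
(* The chain rule holds on the open set [DE], hence near [x], and continuity at [x] only depends on
   values near [x]. *)
- apply: (near_eq_mx_continuous_at (J := fun y => trans_deriv f y *m trans_deriv h (f y))).
    by apply: filterS (near_DE x DEx) => y /chain[].
  apply: mx_continuous_atM; first exact: C1_deriv Cf _ Dx.
  exact: mx_continuous_at_comp (C1_continuous Cf Dx) (C1_deriv Ch Ex).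
- apply: (near_eq_mx_continuous_at
    (J := fun y => invmx (trans_deriv h (f y)) *m invmx (trans_deriv f y))).
    apply: filterS (near_DE x DEx) => y DEy; rewrite (chain y DEy).2 invmxM//.
      exact: C1_unit Cf _ DEy.1.
    exact: C1_unit Ch _ DEy.2.
  apply: mx_continuous_atM; last exact: C1_deriv_inv Cf _ Dx.
  exact: (mx_continuous_at_comp (J := fun y => invmx (trans_deriv h y))
    (C1_continuous Cf Dx) (C1_deriv_inv Ch Ex)).
Qed.

Lemma trans_deriv_comp D E f h x : local_C1_diffeo D f -> local_C1_diffeo E h ->
  D x -> E (f x) -> trans_deriv (h \o f) x = trans_deriv f x *m trans_deriv h (f x).
Proof.
move=> Cf Ch Dx Ex; apply: (differentiable_in_coord_comp _ _ _).2.
- exact: C1_continuous Cf _ Dx.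
- exact: C1_differentiable Cf _ Dx.
- exact: C1_differentiable Ch _ Ex.
Qed.

Lemma trans_deriv_id x : trans_deriv id x = 1%:M.
Proof. exact: jacobian_id. Qed.

Lemma local_C1_diffeo_id D : open D -> local_C1_diffeo D id.
Proof.
move=> oD; split => // x _.
- by move=> A.
- by rewrite trans_deriv_id unitmx1.
- rewrite (_ : trans_deriv id = cst 1%:M); last exact/funext/trans_deriv_id.
  by move=> i j; exact: cst_continuous.
- rewrite (_ : (fun y => _) = cst (invmx 1%:M)); last first.
    by apply/funext => y; rewrite trans_deriv_id.
  by move=> i j; exact: cst_continuous.
Qed.

(** The distortion is a maximum of two operator norms of continuous matrices, hence lower
    semicontinuous. *)
Lemma open_distortion_gt D f a : local_C1_diffeo D f ->
  open [set x | D x /\ a < mx_distortion (trans_deriv f x)].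
Proof.
move=> Cf; rewrite openE => x [Dx ax].
have nD : \forall y \near x, D y.
  by apply: open_nbhs_nbhs; split => //; exact: C1_open Cf.
suff : \forall y \near x, a < mx_distortion (trans_deriv f y).
  by apply: filterS2 nD => y; split.
have /orP[{}ax|{}ax] := etrans (esym (lt_mx_distortion _ _)) ax.
  apply: filterS (near_op_norm_gt (C1_deriv Cf Dx) ax) => y ay.
  by rewrite lt_mx_distortion ay.
apply: filterS (near_op_norm_gt (C1_deriv_inv Cf Dx) ax) => y ay.
by rewrite lt_mx_distortion ay orbT.
Qed.

End LocalDiffeo.

(** * Plaques and transverse changes of coordinates *)

Section RowBlocks.
Context {T : topologicalType} {p q : nat}.

Lemma continuous_rsubmx : continuous (@rsubmx T 1 p q).
Proof.
move=> v A [P vP PA].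
(* Neighbourhoods of matrices are given entrywise: the last [q] entries are constrained by [P], the
   first [p] are free. *)
exists (fun i j => if fintype.split j is inr j' then P i j' else setT) => [i j|w Pw].
  case: fintype.splitP => j' jE; first exact: filterT.
  have -> : j = rshift p j' by exact/val_inj.
  by have := vP i j'; rewrite mxE.
apply: PA => i j; have := Pw i (rshift p j); rewrite mxE.
by rewrite (_ : fintype.split _ = inr j)//; exact: (unsplitK (inr j)).
Qed.

Lemma continuous_row_mx (l : 'rV[T]_p) : continuous (@row_mx T 1 p q l).
Proof.
move=> u A [P uP PA].
exists (fun i j => P i (rshift p j)) => [i j|w Pw].
  by have := uP i (rshift p j); rewrite row_mxEr.
apply: PA => i j; have := uP i j; rewrite !mxE.
case: fintype.splitP => j' jE; first exact: nbhs_singleton.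
have -> : j = rshift p j' by exact/val_inj.
by move=> _; exact: Pw.
Qed.

End RowBlocks.

Section Holonomy.
Context (R : realType) (p q : nat) (M : topologicalType).
Context (A : smooth_atlas R (p + q) M) (g : riemannian_metric A).
Context (F : foliation R p q M) (k : nat) (C : foliation_cover g F k).
Local Notation X := (copies R q k).
Implicit Types (i j : 'I_k) (z w : M) (u : 'rV[R]_q) (x y : X).

(** The projection of U_i to T_i: a plaque is represented by the point where it meets the
    transversal. *)
Definition plaque i z : X := copy i (rsubmx (fc_phi C i z)).

Lemma fc_homeo i : is_homeo (fc_dom C i) (@cube R (p + q) 1) (fc_phi C i) (fc_psi C i).
Proof. exact: fol_chart_homeo (fc_dom_chart C i). Qed.

Lemma open_fc_dom i : open (fc_dom C i).
Proof. exact: homeo_open_dom (fc_homeo i). Qed.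

Lemma cube_row_mx (l : 'rV[R]_p) u r : cube r l -> cube r u -> cube r (row_mx l u).
Proof. by move=> cl cu j; rewrite mxE; case: fintype.splitP. Qed.

Lemma cube0 n : cube 1 (0 : 'rV[R]_n).
Proof. by move=> j; rewrite mxE normr0. Qed.

Lemma plaque_transversal i z : fc_dom C i z -> complete_transversal (plaque i z).
Proof. by move=> /(homeo_fun (fc_homeo i)) cz j; rewrite /= mxE. Qed.

Lemma plaque_trans_pt x : complete_transversal x ->
  fc_dom C (projT1 x) (trans_pt C x) /\ plaque (projT1 x) (trans_pt C x) = x.
Proof.
move=> Tx; have cx : cube 1 (row_mx (0 : 'rV[R]_p) (projT2 x : 'rV[R]_q)).
  by apply: cube_row_mx => //; exact: cube0.
split; first exact: homeo_inv_fun (fc_homeo _) _ cx.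
rewrite /plaque /trans_pt (homeo_invK (fc_homeo _) cx) row_mxKr.
exact: copy_projK.
Qed.

Lemma leaf_sym z w : leaf F z w -> leaf F w z.
Proof. by move=> /(leaf_eq) ->; exact: leaf_refl. Qed.

Lemma leaf_trans z w v : leaf F z w -> leaf F w v -> leaf F z v.
Proof. by move=> /(leaf_eq) ->. Qed.

Lemma leaf_plaque i z w : fc_dom C i z -> fc_dom C i w ->
  plaque i z = plaque i w -> leaf F z w.
Proof.
move=> Uz Uw /(congr1 (fun x : X => projT2 x : 'rV[R]_q)) /= zw.
have := fol_chart_plaque (fc_dom_chart C i) Uz.
move=> /(congr1 (fun B : set M => B w)) E.
have /connected_component_sub[] // : connected_component (leaf F z `&` fc_dom C i) z w.
by rewrite E.
Qed.

Lemma leaf_trans_pt_plaque i z : fc_dom C i z -> leaf F z (trans_pt C (plaque i z)).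
Proof.
move=> Uz; have [Ut tE] := plaque_trans_pt (plaque_transversal Uz).
exact: (leaf_plaque Uz Ut (esym tE)).
Qed.

Lemma continuous_plaque i z : fc_dom C i z -> {for z, continuous (plaque i)}.
Proof.
move=> Uz; apply: (continuous_comp (f := fun w => rsubmx (fc_phi C i w))
  (g := @copy R q k i)).
  apply: (continuous_comp (f := fc_phi C i)); last exact: continuous_rsubmx.
  exact: homeo_cont (fc_homeo i) _ Uz.
exact: existT_continuous.
Qed.

Lemma open_trans_dom i j : open (trans_dom C i j).
Proof.
rewrite openE => _ [z [Uz Vz] <-]; set v := fc_phi C i z; set u := rsubmx v.
have uv : row_mx (lsubmx v) u = v by exact: hsubmxK.
(* Moving only the last [q] coordinates of [phi_i(z)] gives a slice through [z], whose points near
   [z] stay in both charts. *)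
have nv : \forall y \near v, cube 1 y /\ fc_dom C j (fc_psi C i y).
  have cv : cube 1 v by exact: homeo_fun (fc_homeo i) _ Uz.
  apply: filterI.
    by apply: open_nbhs_nbhs; split => //; exact: homeo_open_img (fc_homeo i).
  apply: (homeo_inv_cont (fc_homeo i) cv); rewrite (homeo_funK (fc_homeo i) Uz).
  by apply: open_nbhs_nbhs; split => //; exact: open_fc_dom.
rewrite -uv in nv.
have : \forall y \near u, cube 1 (row_mx (lsubmx v) y) /\
    fc_dom C j (fc_psi C i (row_mx (lsubmx v) y)) := continuous_row_mx nv.
apply: filterS => y [cy Vy]; exists (fc_psi C i (row_mx (lsubmx v) y)).
  by split => //; exact: homeo_inv_fun (fc_homeo i) _ cy.
by rewrite (homeo_invK (fc_homeo i) cy) row_mxKr.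
Qed.

Lemma trans_dom_cube i j u : trans_dom C i j u -> cube 1 u.
Proof. by move=> [z [Uz _] <-]; exact: plaque_transversal Uz. Qed.

Lemma cube_trans_dom i u : cube 1 u -> trans_dom C i i u /\ trans_change C i i u = u.
Proof.
move=> cu; have [Uz E] := plaque_trans_pt (x := copy i u) cu.
have {}E : rsubmx (fc_phi C i (trans_pt C (copy i u))) = u.
  exact: (congr1 (fun x : X => projT2 x : 'rV[R]_q) E).
by split; [exists (trans_pt C (copy i u))|rewrite -{1}E (trans_changeP Uz Uz)].
Qed.

Lemma trans_changeK i j u : trans_dom C i j u ->
  trans_dom C j i (trans_change C j i u) /\ trans_change C i j (trans_change C j i u) = u.
Proof.
move=> [z [Uz Vz] <-]; rewrite (trans_changeP Uz Vz) (trans_changeP Vz Uz).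
by split => //; exists z.
Qed.

(** In copy [i] the transversal is the domain of h_{i,i}, which is open. *)
Lemma open_complete_transversal : open (@complete_transversal R q k).
Proof.
apply/sigT_openP => i; rewrite (_ : _ @^-1` _ = trans_dom C i i).
  exact: open_trans_dom.
apply/seteqP; split=> u; last exact: trans_dom_cube.
by move=> /(cube_trans_dom i)[].
Qed.

End Holonomy.

(** * Words in the generators of the holonomy pseudogroup *)

Section ClassC1.
Context {R : realType} {q : nat}.

Lemma class_C1_jacobian (U : set 'rV[R]_q) (f : 'rV[R]_q -> 'rV[R]_q) u :
  open U -> class_C 1 U f -> U u -> mx_continuous_at (fun v => 'J f v) u.
Proof.
move=> oU [df cf] Uu.
(* The matrix of partial derivatives, continuous by the C^1 hypothesis; it is the jacobian only
   where [f] is known to be differentiable, that is, on [U]. *)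
pose D v : 'M[R]_q := \matrix_(i, j) ('D_(delta_mx 0 i) f v : 'rV[R]_q) 0 j.
have DE v : U v -> D v = 'J f v.
  move=> Uv; apply/matrixP => i j.
  have := congr1 (fun r : 'rV[R]_q => r 0 j) (rowE i ('J f v)).
  rewrite mxE => ->; rewrite mxE deriveEjacobian//; exact: df.
apply: (@near_eq_mx_continuous_at R 'rV[R]_q q q D (fun v => 'J f v) u).
  have : \forall v \near u, U v by exact: open_nbhs_nbhs.
  by apply: filterS => v /DE.
move=> i j.
have cD : {for u, continuous (fun v => ('D_(delta_mx 0 i) f v : 'rV[R]_q) 0 j)}.
  apply: (continuous_comp (f := fun v => 'D_(delta_mx 0 i) f v)
    (g := fun w : 'rV[R]_q => w 0 j)); first exact: cf.
  exact: coord_continuous.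
have -> : (fun v => D v i j) = (fun v => ('D_(delta_mx 0 i) f v : 'rV[R]_q) 0 j).
  by apply/funext => v; rewrite mxE.
exact: cD.
Qed.

Lemma jacobian_near_inverse (f h : 'rV[R]_q -> 'rV[R]_q) u :
  differentiable f u -> differentiable h (f u) ->
  (\forall v \near u, h (f v) = v) -> 'J f u *m 'J h (f u) = 1%:M.
Proof.
move=> df dh hf; rewrite -jacobian_comp//.
have [_ E] := near_eq_differentiable hf (differentiable_comp df dh).
exact: etrans (esym (congr1 (@lin1_mx R q q) E)) (jacobian_id u).
Qed.

End ClassC1.

(** The part of [a, b] where [P] holds is nonempty, relatively open and relatively closed, and the
    segment is connected. *)
Lemma segment_locally_constant (R : realType) (a b : R) (P : R -> Prop) :
  a <= b -> (forall t, a <= t <= b -> \forall s \near t, a <= s <= b -> (P s <-> P t)) ->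
  P a -> P b.
Proof.
move=> ab lP Pa; have itvE (t : R) : `[a, b]%classic t <-> a <= t <= b.
  by rewrite /= in_itv.
(* An open subset of the line whose trace on [a, b] is where [Q] holds, for [Q] either [P] or its
   negation. *)
pose O (Q : R -> Prop) := [set s | `[a, b]%classic s -> Q s]°.
suff E : [set t | `[a, b]%classic t /\ P t] = `[a, b]%classic.
  have : `[a, b]%classic b by apply/itvE; rewrite ab lexx.
  by rewrite -E => -[].
have oO Q : open (O Q) by exact: open_interior.
have PO (Q : R -> Prop) t : (forall s, Q s <-> P s) \/ (forall s, Q s <-> ~ P s) ->
    `[a, b]%classic t -> Q t -> O Q t.
  move=> QP tab Qt; apply: filterS (lP t ((itvE t).1 tab)) => s sP /itvE/sP sPt.
  by case: QP => QP; apply/QP; move/QP: Qt; rewrite sPt.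
apply: (@segment_connected R a b).
- by exists a; split => //; apply/itvE; rewrite lexx.
- exists (O P) => //; apply/seteqP; split=> t [tab].
    by move=> Pt; split => //; apply: PO Pt => //; left.
  by move=> /nbhs_singleton/(_ tab).
- exists (~` O (fun s => ~ P s)); first exact: open_closedC.
  apply/seteqP; split=> t [tab].
    by move=> Pt; split => // /nbhs_singleton/(_ tab).
  by move=> nO; split => //; apply: contrapT => nP; apply: nO; apply: PO => //; right.
Qed.

Section Words.
Context (R : realType) (p q : nat) (M : topologicalType).
Context (A : smooth_atlas R (p + q) M) (g : riemannian_metric A).
Context (F : foliation R p q M) (k : nat) (C : foliation_cover g F k).
Local Notation X := (copies R q k).
Implicit Types (i j : 'I_k) (z w : M) (u : 'rV[R]_q) (x y : X).
Implicit Types s : seq ('I_k * 'I_k).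

(** The head of the list is applied last. Lists of pairs form a countable type; a letter with empty
    overlap has empty domain, so it occurs in no word defined at a point. *)
Definition word s : Defs.pmap X :=
  foldr (fun ij f => Defs.pcomp (hol_gen C ij.1 ij.2) f)
    (PMap (@complete_transversal R q k) id) s.

Lemma word_catE s t : pfun (word (t ++ s)) =1 word t \o word s.
Proof. by move=> x; elim: t => //= ij t ->. Qed.

Lemma word_cat s t x : pdom (word s) x -> pdom (word t) (word s x) ->
  pdom (word (t ++ s)) x.
Proof.
move=> Ds; elim: t => [//|ij t IH] /= [/IH Dt Dij]; split=> //.
by rewrite /preimage /= word_catE.
Qed.

Definition reachable x y := exists2 s, pdom (word s) x & word s x = y.

Lemma reachable_plaque x i j z : fc_dom C i z -> fc_dom C j z ->
  reachable x (plaque C i z) -> reachable x (plaque C j z).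
Proof.
move=> Uz Vz [s Ds sx]; exists ((i, j) :: s).
  split => //=; rewrite /preimage /= sx.
  by exists (rsubmx (fc_phi C i z)) => //; exists z.
by rewrite /= sx /= (trans_changeP Uz Vz).
Qed.

(** A short piece of a path in a leaf is a connected subset of the trace of the leaf on U_i, hence
    lies in a single component, a plaque. *)
Lemma near_plaque_path (c : R -> M) t i :
  continuous c -> fc_dom C i (c t) ->
  (forall r, 0 <= r <= 1 -> leaf F (c t) (c r)) -> 0 <= t <= 1 ->
  \forall r \near t, 0 <= r <= 1 ->
    fc_dom C i (c r) /\ plaque C i (c r) = plaque C i (c t).
Proof.
move=> cc Ut Lt t01.
have : \forall r \near t, fc_dom C i (c r).
  by apply: (cc t); apply: open_nbhs_nbhs; split => //; exact: open_fc_dom.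
move=> /nbhs_ballP[e /= e0 eU].
exists e => //= s te s01; split; first exact: eU.
pose I := [set r | 0 <= r <= 1 /\ `|t - r| < e].
have II : is_interval I.
  move=> a b [/andP[a0 a1] ta] [/andP[b0 b1] tb] r /andP[ar rb]; split.
    by rewrite (le_trans a0 ar) (le_trans rb b1).
  by move: ta tb; rewrite !ltr_norml => /andP[? ?] /andP[? ?]; lra.
have cI : connected (c @` I).
  apply: connected_continuous_connected; first exact/connected_intervalP.
  exact: continuous_subspaceT.
have : connected_component (leaf F (c t) `&` fc_dom C i) (c t) (c s).
  apply: (connected_component_max _ _ cI); last by exists s.
    by exists t => //; split => //; rewrite subrr normr0.
  by move=> _ [r [r01 tr] <-]; split; [exact: Lt|exact: eU].
rewrite (fol_chart_plaque (fc_dom_chart C i) Ut) => -[_ E].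
by rewrite /plaque E.
Qed.

Lemma leaf_reachable i j z w : fc_dom C i z -> fc_dom C j w -> leaf F z w ->
  reachable (plaque C i z) (plaque C j w).
Proof.
move=> Uz Vw zw; have [c [cc c0 c1 Lc]] := leaf_path_connected zw.
pose x := plaque C i z.
(* Quantifying over all charts around [c t] makes [P] locally constant: nearby points share a plaque
   of one chart, and one more letter passes to any other chart. *)
pose P t := forall a, fc_dom C a (c t) -> reachable x (plaque C a (c t)).
have locP (t : R) : 0 <= t <= 1 -> \forall r \near t, 0 <= r <= 1 -> (P r <-> P t).
  move=> t01; have [a Ua] := fc_covers C (c t).
  have Lt r : 0 <= r <= 1 -> leaf F (c t) (c r).
    by move=> r01; apply: leaf_trans (Lc r r01); apply/leaf_sym/Lc.
  apply: filterS (near_plaque_path cc Ua Lt t01) => s H s01.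
  have [Us E] := H s01; split=> Ps b Ub.
    by apply: (reachable_plaque Ua Ub); rewrite -E; exact: Ps.
  by apply: (reachable_plaque Us Ub); rewrite E; exact: Ps.
have P0 : P 0.
  rewrite /P c0 => a Ua; apply: (reachable_plaque Uz Ua); exists [::] => //.
  exact: plaque_transversal Uz.
have P1 : P 1 by exact: (segment_locally_constant ler01 locP).
by rewrite -c1; apply: P1; rewrite c1.
Qed.

Hypothesis FC1 : foliation_C C 1.

Lemma trans_dom_overlap i j u : trans_dom C i j u -> overlap C i j.
Proof. by move=> [z Uz _]; exists z. Qed.

(** The chain rule for h_{i,j} after h_{j,i}, which is the identity near [u]. *)
Lemma jacobian_trans_change i j u : trans_dom C i j u ->
  'J (trans_change C j i) u *m 'J (trans_change C i j) (trans_change C j i u) = 1%:M.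
Proof.
move=> Du; have [Dv _] := trans_changeK Du.
apply: jacobian_near_inverse.
- exact: (FC1 (trans_dom_overlap Du)).1 Du.
- exact: (FC1 (trans_dom_overlap Dv)).1 Dv.
- have : \forall v \near u, trans_dom C i j v.
    by apply: open_nbhs_nbhs; split => //; exact: open_trans_dom.
  by apply: filterS => v /trans_changeK[].
Qed.

Lemma local_C1_diffeo_hol_gen i j :
  local_C1_diffeo (pdom (hol_gen C i j)) (hol_gen C i j).
Proof.
have oD : open (pdom (hol_gen C i j)) by exact/existT_open_map/open_trans_dom.
have J y : trans_deriv (hol_gen C i j) y =
  'J (trans_change C j i) (projT2 y : 'rV[R]_q) by [].
split => // _ [u Du <-].
- apply: (continuous_comp (f := fun x : X => trans_change C j i (projT2 x))).
    apply: (continuous_comp (f := fun x : X => projT2 x : 'rV[R]_q)).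
      exact: continuous_projT2.
    exact/differentiable_continuous/(FC1 (trans_dom_overlap Du)).1.
  exact: existT_continuous.
- exact: (FC1 (trans_dom_overlap Du)).1 Du.
- exact: (mulmx1_unit (jacobian_trans_change Du)).1.
- apply: (mx_continuous_at_comp (f := fun x : X => projT2 x : 'rV[R]_q)
    (J := fun v => 'J (trans_change C j i) v)); first exact: continuous_projT2.
  exact: (class_C1_jacobian (@open_trans_dom _ _ _ _ _ _ _ _ C i j)
    (FC1 (trans_dom_overlap Du)) Du).
(* The inverse derivative of h_{j,i} is the derivative of h_{i,j} at the image point. *)
- apply: (near_eq_mx_continuous_at (J := fun x : X =>
      'J (trans_change C i j) (trans_change C j i (projT2 x)))).
    have : \forall y \near (copy i u : X), pdom (hol_gen C i j) y.
      by apply: open_nbhs_nbhs; split => //; exists u.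
    apply: filterS => _ [v Dv <-]; rewrite J.
    have JJ := jacobian_trans_change Dv; have [uJ _] := mulmx1_unit JJ.
    by rewrite -[LHS](mulKmx uJ) JJ mulmx1.
  have [Dv _] := trans_changeK Du.
  apply: (mx_continuous_at_comp (f := fun x : X => trans_change C j i (projT2 x))
    (J := fun v => 'J (trans_change C i j) v)).
    apply: (continuous_comp (f := fun x : X => projT2 x : 'rV[R]_q)).
      exact: continuous_projT2.
    exact/differentiable_continuous/(FC1 (trans_dom_overlap Du)).1.
  exact: (class_C1_jacobian (@open_trans_dom _ _ _ _ _ _ _ _ C j i)
    (FC1 (trans_dom_overlap Dv)) Dv).
Qed.

Lemma local_C1_diffeo_word s : local_C1_diffeo (pdom (word s)) (word s).
Proof.
elim: s => [|[i j] s IH]; first exact: local_C1_diffeo_id (open_complete_transversal C).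
exact: local_C1_diffeo_comp IH (local_C1_diffeo_hol_gen i j).
Qed.

End Words.

(** * Germs and distortion *)

Section Germs.
Context (R : realType) (p q : nat) (M : topologicalType).
Context (A : smooth_atlas R (p + q) M) (g : riemannian_metric A).
Context (F : foliation R p q M) (k : nat) (C : foliation_cover g F k).
Hypothesis FC1 : foliation_C C 1.
Local Notation X := (copies R q k).
Local Notation T := (@complete_transversal R q k).
Implicit Types (i j : 'I_k) (x y : X).
Implicit Types s t : seq ('I_k * 'I_k).

Lemma eq_germ x (f h : X -> X) : (\forall y \near x, f y = h y) -> germ x f = germ x h.
Proof.
by move=> fh; apply/seteqP; split=> f'; apply: filterS2 fh => y -> .
Qed.

Lemma holonomy_word h x : holonomy C h -> pdom h x ->
  exists2 s, pdom (word C s) x & \forall y \near x, h y = word C s y.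
Proof.
move=> Hh; elim: Hh x => {h} [h [i [j [_ ->]]]|h f _ IHh _ IHf|h V _ IH _] x.
(* A one-letter word begins with the identity of the transversal, so its domain also asks that the
   point lie in a cube. *)
- move=> Dx; exists [:: (i, j)]; last exact: filterE.
  by split => //=; case: Dx => u Du <-; exact: trans_dom_cube Du.
- move=> [/IHf[s Ds fs] /IHh[t Dt ht]].
  have fxs := nbhs_singleton fs.
  rewrite fxs in Dt ht; exists (t ++ s); first exact: word_cat.
  have := C1_continuous (local_C1_diffeo_word FC1 s) Ds ht.
  by apply: filterS2 fs => y /= -> ->; rewrite word_catE.
- by move=> [/IH].
Qed.

Lemma word_holonomy s x : pdom (word C s) x ->
  exists h, [/\ holonomy C h, pdom h x & \forall y \near x, h y = word C s y].
Proof.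
elim: s => [|[i j] s IH] /=.
  (* The empty word is realised near [x] by h_{i,i}, with [i] the copy containing [x]. *)
  move=> Tx; pose i := projT1 x; exists (hol_gen C i i).
  have Di : trans_dom C i i (projT2 x) by exact: (cube_trans_dom C i Tx).1.
  split.
  - by apply: holonomy_gen; exists i, i; split => //; exact: trans_dom_overlap Di.
  - by exists (projT2 x) => //; exact: copy_projK.
  - apply/near_copy.
    have : \forall u \near (projT2 x : 'rV[R]_q), trans_dom C i i u.
      by apply: open_nbhs_nbhs; split => //; exact: open_trans_dom.
    by apply: filterS => u /trans_dom_cube/(cube_trans_dom C i)[_ /= ->].
move=> [/IH[h [Hh Dh hs]] Dij]; exists (Defs.pcomp (hol_gen C i j) h).
have hxs := nbhs_singleton hs; split.
- apply: holonomy_comp Hh; apply: holonomy_gen; exists i, j; split => //.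
  by case: Dij => u /trans_dom_overlap.
- by split => //; rewrite /preimage /= hxs.
- by apply: filterS hs => y /= ->.
Qed.

Lemma germs_atP x gam : germs_at C x gam <->
  exists2 s, pdom (word C s) x & gam = germ x (word C s).
Proof.
split=> [[h [Hh Dh] <-]|[s /word_holonomy[h [Hh Dh hs]] ->]].
  by have [s Ds hs] := holonomy_word Hh Dh; exists s => //; exact: eq_germ.
by exists h => //; exact: eq_germ.
Qed.

Lemma hol_wordsP m x gam : is_word_germ C x gam m <->
  exists s, [/\ size s = m, pdom (word C s) x & gam = germ x (word C s)].
Proof.
split=> [[h [Wh Dh ->]]|[s [<- Ds ->]]].
  suff [s sm sh] : exists2 s, size s = m & h = word C s by exists s; rewrite -sh.
  elim: m h Wh {Dh} => [|m IH] h /=; first by move=> ->; exists [::].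
  move=> [_ [i [j [_ ->]]] [f /IH[s sm ->] <-]].
  by exists ((i, j) :: s) => //=; rewrite sm.
exists (word C s); split => //; elim: s Ds => [//|[i j] s IH] /= [Ds Dij].
exists (hol_gen C i j); last by exists (word C s) => //; exact: IH.
by exists i, j; split => //; case: Dij => u /trans_dom_overlap.
Qed.

Lemma word_length_le x gam l : germs_at C x gam ->
  (word_length C x gam <= l)%N <->
  exists s, [/\ (size s <= l)%N, pdom (word C s) x & gam = germ x (word C s)].
Proof.
move=> /germs_atP[s0 D0 E0].
have [wg minwg] : is_word_germ C x gam (word_length C x gam) /\
    forall m, is_word_germ C x gam m -> (word_length C x gam <= m)%N.
  (* Some word represents the germ, so the minimum exists and the default 0 of [xget] does not
     intervene. *)
  have ex : exists m, `[< is_word_germ C x gam m >].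
    by exists (size s0); apply/asboolP/hol_wordsP; exists s0.
  apply: (xgetPex 0%N (P := [set m | is_word_germ C x gam m /\
    forall m', is_word_germ C x gam m' -> (m <= m')%N])).
  case: (ex_minnP ex) => m /asboolP wm minm; exists m; split => // m' wm'.
  by apply: minm; exact/asboolP.
split=> [wl|[s [sl Ds sE]]].
  by have [s [sm Ds sE]] := (hol_wordsP _ _ _).1 wg; exists s; rewrite sm.
by apply: leq_trans sl; apply: minwg; apply/hol_wordsP; exists s.
Qed.

Definition word_dist s x : R := mx_distortion (trans_deriv (word C s) x).

Lemma distortion_word s x : pdom (word C s) x ->
  distortion x (germ x (word C s)) = word_dist s x.
Proof.
move=> Ds; suff E : germ_deriv x (germ x (word C s)) = trans_deriv (word C s) x.
  exact: (congr1 (@mx_distortion R q) E).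
apply: near_eq_trans_deriv.
  exact: C1_differentiable (local_C1_diffeo_word FC1 s) _ Ds.
(* The representative picked by [xget] lies in the germ, which is nonempty. *)
have : germ x (word C s) (xget (@id X) (germ x (word C s))).
  by apply: xgetPex; exists (pfun (word C s)); exact: filterE.
exact.
Qed.

(* The derivative of [t] at [word s x] is (D_x s)^-1 D_x (t ++ s), in the row
   convention. *)
Lemma word_dist_cat s t x : pdom (word C s) x -> pdom (word C t) (word C s x) ->
  word_dist t (word C s x) <= word_dist s x * word_dist (t ++ s) x.
Proof.
move=> Ds Dt.
have Cs := local_C1_diffeo_word FC1 s; have Ct := local_C1_diffeo_word FC1 t.
have us := C1_unit Cs Ds.
have E : trans_deriv (word C (t ++ s)) x =
    trans_deriv (word C s) x *m trans_deriv (word C t) (word C s x).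
  by rewrite -(trans_deriv_comp Cs Ct Ds Dt); congr trans_deriv; exact/funext/word_catE.
have -> : word_dist t (word C s x) =
    mx_distortion (invmx (trans_deriv (word C s) x) *m trans_deriv (word C (t ++ s)) x).
  by rewrite E (mulKmx us).
have uV : invmx (trans_deriv (word C s) x) \in unitmx by rewrite unitmx_inv.
have uts := C1_unit (local_C1_diffeo_word FC1 (t ++ s)) (word_cat Ds Dt).
by have := mx_distortionM uV uts; rewrite mx_distortionV.
Qed.

(** * Bounded distortion and subexponential growth of distortion *)

Definition bounded_dist x := exists B : nat, forall s,
  pdom (word C s) x -> word_dist s x <= B%:R.

(** The vanishing of the expansion rate, freed of logarithms and with all quantifiers over countable
    types: rates 1/(n+1), lengths, and words. *)
Definition slow_dist x := forall n : nat, exists N : nat, forall l : nat, forall s,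
  (N <= l)%N -> (size s <= l)%N -> pdom (word C s) x ->
  word_dist s x <= expR (n.+1%:R^-1 * l%:R).

Lemma bounded_slow x : bounded_dist x -> slow_dist x.
Proof.
(* B <= 1 + B <= exp B, and B <= l/(n+1) once l >= B(n+1). *)
move=> [B HB] n; exists (B * n.+1)%N => l s Nl _ Ds.
apply: (le_trans (HB s Ds)); apply: (@le_trans _ _ (1 + B%:R)); first by rewrite lerDr.
apply: (le_trans (expR_ge1Dx _)); rewrite ler_expR mulrC ler_pdivlMr ?ltr0n//.
by rewrite -natrM ler_nat.
Qed.

Lemma bounded_reachable x y : reachable C x y -> bounded_dist x -> bounded_dist y.
Proof.
(* One factor [B] bounds [s] and the other bounds [t ++ s], both at [x]. *)
move=> [s Ds <-] [B HB]; exists (B * B)%N => t Dt.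
apply: (le_trans (word_dist_cat Ds Dt)); rewrite natrM.
by apply: ler_pM; rewrite ?mx_distortion_ge0//; apply: HB => //; exact: word_cat.
Qed.

Lemma slow_reachable x y : reachable C x y -> slow_dist x -> slow_dist y.
Proof.
(* Half the target rate, 1/(2n+2), is requested at [x]. The constant distortion of [s] is at most
   exp K, and K + (l + |s|)/(2n+2) <= l/(n+1) as soon as l >= K(2n+2) + |s|. *)
move=> [s Ds <-] slow n; have [N HN] := slow n.*2.+1.
pose K := (Num.truncn (word_dist s x)).+1.
exists (maxn N (K * n.*2.+2 + size s)) => l t; rewrite geq_max => /andP[Nl Kl] tl Dt.
apply: (le_trans (word_dist_cat Ds Dt)).
have n0 : 0 < n.*2.+2%:R :> R by rewrite ltr0n.
apply: (@le_trans _ _ (expR K%:R * expR (n.*2.+2%:R^-1 * (l + size s)%:R))).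
  apply: ler_pM; rewrite ?mx_distortion_ge0//.
    apply: (le_trans (ltW (truncnS_gt _))).
    by apply: le_trans (expR_ge1Dx _); rewrite lerDr.
  apply: HN; [exact: leq_trans Nl (leq_addr _ _)| |exact: word_cat].
  by rewrite size_cat leq_add2r.
rewrite -expRD ler_expR.
have -> : K%:R = n.*2.+2%:R^-1 * (K * n.*2.+2)%:R :> R.
  by rewrite natrM mulrCA mulVf ?mulr1// gt_eqF.
have -> : n.+1%:R^-1 * l%:R = n.*2.+2%:R^-1 * (l + l)%:R :> R.
  rewrite -doubleS addnn -!muln2 !natrM invfM -mulrA; congr (_ * _).
  by rewrite mulrCA mulVf ?mulr1.
by rewrite -mulrDr -natrD ler_pM2l ?invr_gt0// ler_nat addnCA leq_add2l.
Qed.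

End Germs.

(** * The decomposition *)

Section Classification.
Context (R : realType) (p q : nat) (M : topologicalType).
Context (A : smooth_atlas R (p + q) M) (g : riemannian_metric A).
Context (F : foliation R p q M) (k : nat) (C : foliation_cover g F k).
Hypothesis FC1 : foliation_C C 1.
Local Notation X := (copies R q k).
Local Notation T := (@complete_transversal R q k).
Implicit Types (i j : 'I_k) (x y : X).
Implicit Types s t : seq ('I_k * 'I_k).

Lemma ln_le_expR (d a : R) : 0 <= d -> 0 <= a -> (ln d <= a) = (d <= expR a).
Proof.
(* At [d = 0] both sides hold, because [ln 0 = 0] and [a] is nonnegative. *)
move=> d0 a0; have [->|d0'] := eqVneq d 0; first by rewrite ln0// a0 expR_ge0.
have dp : d \is Num.pos by rewrite posrE lt_neqAle eq_sym d0'.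
by rewrite -{2}(lnK dp) ler_expR.
Qed.

(* For [n = 0] the norm is 0, and [ln 0 = 0]. *)
Lemma ln_op_norm1_ge0 n : 0 <= ln (op_norm (1%:M : 'M[R]_n)).
Proof.
have [[v v0]|nv] := pselect (exists v : 'rV[R]_n, eucl_norm v != 0).
  apply: ln_ge0; have := eucl_norm_mulmx 1%:M v.
  by rewrite mulmx1 -{1}[eucl_norm v]mul1r ler_pM2r// lt_neqAle eq_sym v0 eucl_norm_ge0.
rewrite ln0//; apply: op_norm_le => v _; rewrite mulmx1.
by apply: contra_notT nv; rewrite -ltNge => /gt_eqF v0; exists v; rewrite v0.
Qed.

Lemma expansion_at_le l x (a : R) : T x -> (0 < l)%N -> 0 <= a ->
  (expansion_at C l x <= a%:E)%E <->
  forall s, (size s <= l)%N -> pdom (word C s) x -> word_dist C s x <= expR (a * l%:R).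
Proof.
move=> Tx l0 a0.
have lnP s : (ln (word_dist C s x) / l%:R <= a) = (word_dist C s x <= expR (a * l%:R)).
  by rewrite ler_pdivrMr ?ltr0n// ln_le_expR ?mx_distortion_ge0 ?mulr_ge0.
split=> [ea s sl Ds|H].
  rewrite -lnP -lee_fin -(distortion_word FC1 Ds); apply: le_trans ea.
  apply: ereal_sup_ubound; exists (germ x (word C s)) => //.
  have gs : germs_at C x (germ x (word C s)) by apply/(germs_atP FC1); exists s.
  by split => //; apply/(word_length_le FC1 _ gs); exists s.
apply: ge_ereal_sup => _ [gam [gg gl] <-]; rewrite lee_fin.
have [s [sl Ds ->]] := (word_length_le FC1 l gg).1 gl.
by rewrite (distortion_word FC1 Ds) lnP; exact: H.
Qed.

(** The identity germ, represented by the empty word, always competes in the supremum. *)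
Lemma expansion_at_ge0 l x : T x -> (0 <= expansion_at C l x)%E.
Proof.
move=> Tx; have D0 : pdom (word C [::]) x by [].
have g0 : germs_at C x (germ x (word C [::])) by apply/(germs_atP FC1); exists [::].
apply: (@le_trans _ _ (ln (distortion x (germ x (word C [::]))) / l%:R)%:E).
  rewrite lee_fin divr_ge0// (distortion_word FC1 D0).
  rewrite /word_dist trans_deriv_id /mx_distortion invmx1 maxxx.
  exact: ln_op_norm1_ge0.
apply: ereal_sup_ubound; exists (germ x (word C [::])) => //.
by split => //; apply/(word_length_le FC1 _ g0); exists [::].
Qed.

Lemma expansion_ge0 x : T x -> (0 <= expansion C x)%E.
Proof.
move=> Tx; apply/ereal_infP => _ [V [N _ NV] <-].
apply: le_trans (expansion_at_ge0 N Tx) _.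
by apply: ereal_sup_ubound; exists N => //; apply: NV => /=.
Qed.

Lemma expansion_le0P x : T x -> (expansion C x <= 0)%E <-> slow_dist C x.
Proof.
move=> Tx; split=> [e0 n|slow].
  have n0 : 0 < n.+1%:R^-1 :> R by rewrite invr_gt0 ltr0n.
  have /ereal_inf_lt[_ [V [N _ NV] <-] supV] : (expansion C x < n.+1%:R^-1%:E)%E.
    by apply: le_lt_trans e0 _; rewrite lte_fin.
  (* Length 0 is excluded, since the rate there is a division by 0. *)
  exists (maxn N 1) => l s; rewrite geq_max => /andP[Nl l0] sl Ds.
  apply: ((expansion_at_le Tx l0 (ltW n0)).1 _ s sl Ds).
  apply: le_trans (ltW supV); apply: ereal_sup_ubound; exists l => //; exact: NV.
apply/lee_addgt0Pr => e e0; rewrite add0e.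
(* Chosen so that 1/(n+1) <= e. *)
pose n := Num.truncn e^-1; have [N HN] := slow n.
have n0 : 0 <= n.+1%:R^-1 :> R by rewrite invr_ge0.
have ne : n.+1%:R^-1 <= e.
  by rewrite -[leRHS]invrK lef_pV2 ?posrE ?invr_gt0 ?ltr0n//; exact/ltW/truncnS_gt.
apply: (@le_trans _ _ n.+1%:R^-1%:E); last by rewrite lee_fin.
pose V := [set l | (maxn N 1 <= l)%N].
apply: ge_ereal_inf; exists (ereal_sup [set expansion_at C l x | l in V]).
  by exists V => //; exists (maxn N 1).
apply: ge_ereal_sup => _ [l + <-]; rewrite /V /= geq_max => /andP[Nl l0].
by apply/(expansion_at_le Tx l0 n0) => s sl Ds; exact: HN Nl sl Ds.
Qed.

Lemma ellipticP x : elliptic C x <-> T x /\ bounded_dist C x.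
Proof.
split=> -[Tx]; last first.
  move=> [B HB]; split => //; apply: (@le_lt_trans _ _ B%:R%:E); last exact: ltry.
  apply: ge_ereal_sup => _ [gam /(germs_atP FC1)[s Ds ->] <-].
  by rewrite (distortion_word FC1 Ds) lee_fin; exact: HB.
move=> supoo; split => //; set S := ereal_sup _ in supoo.
(* A natural number above [S], which is finite: it is below +oo and dominates a real distortion. *)
exists (Num.truncn (fine S)).+1 => s Ds.
have sS : ((word_dist C s x)%:E <= S)%E.
  apply: ereal_sup_ubound; exists (germ x (word C s)).
    by apply/(germs_atP FC1); exists s.
  by rewrite (distortion_word FC1 Ds).
apply: le_trans (ltW (truncnS_gt _)); move: supoo sS.
by case: S => [r| |]//= _; rewrite lee_fin.
Qed.

Lemma parabolicP x :
  parabolic C x <-> T x /\ (~ bounded_dist C x /\ slow_dist C x).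
Proof.
split=> [[[Tx nE] e0]|[Tx [nB sl]]].
  split => //; split; first by move=> bx; apply: nE; apply/ellipticP.
  by apply/(expansion_le0P Tx); rewrite e0.
split; first by split => // /ellipticP[].
by apply/eqP; rewrite eq_le expansion_ge0// andbT; apply/(expansion_le0P Tx).
Qed.

Lemma hyperbolicP x : hyperbolic C x <-> T x /\ ~ slow_dist C x.
Proof.
split=> -[Tx ex]; split => //.
  by move=> /(expansion_le0P Tx); rewrite leNgt ex.
by rewrite ltNge; apply/negP => /(expansion_le0P Tx).
Qed.

(** * Borel measurability on the transversal *)

(** The complement in the transversal of the open set where [s] is defined and distorts by more than
    [a]. *)
Lemma borel_word_dist_le s (a : R) :
  borel_subset T [set x | T x /\ (pdom (word C s) x -> word_dist C s x <= a)].
Proof.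
have := open_distortion_gt (a := a) (local_C1_diffeo_word FC1 s).
move=> /(borel_open (D := T))/borel_not bD; apply: eq_borel bD => x.
split=> -[Tx H]; split => //.
  by move=> Ds; rewrite leNgt; apply/negP => aD; exact: H.
by move=> [/H]; rewrite leNgt => /negP.
Qed.

Lemma borel_bounded_dist : borel_subset T [set x | T x /\ bounded_dist C x].
Proof.
by apply: borel_exists => B; apply: borel_forall => s; exact: borel_word_dist_le.
Qed.

Lemma borel_slow_dist : borel_subset T [set x | T x /\ slow_dist C x].
Proof.
apply: borel_forall => n; apply: borel_exists => N; apply: borel_forall => l.
apply: borel_forall => s; apply: borel_imply_cst => _; apply: borel_imply_cst => _.
exact: borel_word_dist_le.
Qed.

(** * Saturation and passage from the transversal to M *)

Lemma trans_saturated_reachable (P : X -> Prop) :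
  (forall x y, reachable C x y -> P x -> P y) ->
  trans_saturated C [set x | T x /\ P x].
Proof.
move=> HP x y [Tx Px] Ty xy; split => //; apply: HP Px.
have [Ux Ex] := plaque_trans_pt C Tx; have [Uy Ey] := plaque_trans_pt C Ty.
by rewrite -Ex -Ey; exact: leaf_reachable.
Qed.

Lemma trans_saturated_not (P : X -> Prop) :
  trans_saturated C [set x | T x /\ P x] ->
  trans_saturated C [set x | T x /\ ~ P x].
Proof.
move=> sP x y [Tx nPx] Ty xy; split => // Py; apply: nPx.
exact: (sP y x (conj Ty Py) Tx (leaf_sym xy)).2.
Qed.

(** By saturation, whether the leaf of [z] meets [E] is decided by the single plaque of [z] in a
    chart, which makes the condition local. *)
Lemma leaves_meetingP (E : set X) z : trans_saturated C E -> E `<=` T ->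
  leaves_meeting C E z <-> exists i, fc_dom C i z /\ E (plaque C i z).
Proof.
move=> sE ET; split=> [[_ [[w ->] [x Ex wx] wz]]|[i [Uz Ez]]].
  have [i Uz] := fc_covers C z; exists i; split => //.
  apply: sE Ex (plaque_transversal Uz) _.
  apply: leaf_trans (leaf_trans_pt_plaque Uz).
  by apply: leaf_trans wz; exact: leaf_sym.
exists (leaf F z); last exact: leaf_refl.
by split; [exists z|exists (plaque C i z) => //; exact: leaf_trans_pt_plaque].
Qed.

Lemma borel_leaves_meeting (E : set X) : trans_saturated C E -> E `<=` T ->
  borel_subset T E -> borel_subset [set: M] (leaves_meeting C E).
Proof.
move=> sE ET bE.
have bU i : borel_subset [set: M]
    [set z | [set: M] z /\ (fc_dom C i z /\ E (plaque C i z))].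
  have := borel_preimage (@open_fc_dom _ _ _ _ _ _ _ _ C i)
    (@plaque_transversal _ _ _ _ _ _ _ _ C i) (@continuous_plaque _ _ _ _ _ _ _ _ C i) bE.
  by apply: eq_borel => z; split=> // -[].
apply: eq_borel (borel_exists bU) => z.
by rewrite leaves_meetingP//; split=> // -[].
Qed.

Lemma fol_saturated_leaves_meeting (E : set X) : fol_saturated F (leaves_meeting C E).
Proof.
exists [set w | exists2 y, E y & leaf F w (trans_pt C y)].
apply/seteqP; split=> [z [_ [[w ->] Ew] wz]|z [w Ew wz]]; first by exists w.
by exists (leaf F w) => //; split => //; exists w.
Qed.

(** A common point may be seen in different charts for [E] and [E']; saturation brings both to the
    same point of the transversal. *)
Lemma leaves_meetingI0 (E E' : set X) : trans_saturated C E -> trans_saturated C E' ->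
  E `<=` T -> E' `<=` T -> E `&` E' = set0 ->
  leaves_meeting C E `&` leaves_meeting C E' = set0.
Proof.
move=> sE sE' ET ET' EE'; apply/seteqP; split => // z [].
move=> /(leaves_meetingP _ sE ET)[i [Uz Ez]] /(leaves_meetingP _ sE' ET')[j [Vz Ez']].
have : (E `&` E') (plaque C i z); last by rewrite EE'.
split => //; apply: sE' Ez' (plaque_transversal Uz) _.
apply: leaf_trans (leaf_trans_pt_plaque Uz).
exact/leaf_sym/leaf_trans_pt_plaque.
Qed.

End Classification.

Theorem theorem1p3 (R : realType) (p q k : nat) (M : topologicalType)
    (A : smooth_atlas R (p + q) M) (g : riemannian_metric A)
    (F : foliation R p q M) (C : foliation_cover g F k)
    (Mcompact : compact [set: M]) (Mhausdorff : hausdorff_space M)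
    (FC1 : foliation_C C 1) :
  let ER := elliptic C in
  let PR := parabolic C in
  let HR := hyperbolic C in
  let T := @complete_transversal R q k in
  let EF := leaves_meeting C ER in
  let PF := leaves_meeting C PR in
  let HF := leaves_meeting C HR in
  [/\ trans_saturated C ER, trans_saturated C PR & trans_saturated C HR] /\
  [/\ borel_subset T ER, borel_subset T PR & borel_subset T HR] /\
  [set: M] = EF `|` PF `|` HF /\
  [/\ EF `&` PF = set0, EF `&` HF = set0 & PF `&` HF = set0] /\
  [/\ fol_saturated F EF, fol_saturated F PF & fol_saturated F HF] /\
  [/\ borel_subset [set: M] EF, borel_subset [set: M] PF
    & borel_subset [set: M] HF].
Proof.
move=> ER PR HR T EF PF HF.
have EE : ER = [set x | T x /\ bounded_dist C x].
  by apply/seteqP; split=> x /(ellipticP FC1).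
have PE : PR = [set x | T x /\ (~ bounded_dist C x /\ slow_dist C x)].
  by apply/seteqP; split=> x /(parabolicP FC1).
have HE : HR = [set x | T x /\ ~ slow_dist C x].
  by apply/seteqP; split=> x /(hyperbolicP FC1).
have sB : trans_saturated C [set x | T x /\ bounded_dist C x].
  by apply: trans_saturated_reachable => x y; exact: bounded_reachable.
have sE : trans_saturated C ER by rewrite EE.
have sS : trans_saturated C [set x | T x /\ slow_dist C x].
  by apply: trans_saturated_reachable => x y; exact: slow_reachable.
have sH : trans_saturated C HR by rewrite HE; exact: trans_saturated_not.
have sP : trans_saturated C PR.
  rewrite PE => x y [Tx [nb sl]] Ty xy; split => //; split.
    exact: (trans_saturated_not sB (conj Tx nb) Ty xy).2.
  exact: (sS x y (conj Tx sl) Ty xy).2.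
have ET : ER `<=` T by rewrite EE => x [].
have PT : PR `<=` T by rewrite PE => x [].
have HT : HR `<=` T by rewrite HE => x [].
have bE : borel_subset T ER by rewrite EE; exact: borel_bounded_dist.
have bH : borel_subset T HR by rewrite HE; exact: borel_not (borel_slow_dist FC1).
have bP : borel_subset T PR.
  rewrite PE; apply: borel_and; last exact: borel_slow_dist.
  exact: borel_not (borel_bounded_dist FC1).
split; first by [].
split; first by [].
split.
  apply/seteqP; split => // z _; have [i Uz] := fc_covers C z.
  have Tz := plaque_transversal Uz.
  have [sz|nsz] := pselect (slow_dist C (plaque C i z)).
    have [bz|nbz] := pselect (bounded_dist C (plaque C i z)).
      by left; left; apply/leaves_meetingP => //; exists i; rewrite EE.
    by left; right; apply/leaves_meetingP => //; exists i; rewrite PE.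
  by right; apply/leaves_meetingP => //; exists i; rewrite HE.
split.
  split; apply: leaves_meetingI0 => //; rewrite ?EE ?PE ?HE; apply/seteqP; split => // x.
  - by move=> [[_ bx] [_ [nbx _]]].
  (* Bounded distortion forces rate zero, so elliptic points are not hyperbolic. *)
  - by move=> [[_ /(bounded_slow) sx] [_ nsx]].
  - by move=> [[_ [_ sx]] [_ nsx]].
split; first by split; exact: fol_saturated_leaves_meeting.
by split; exact: borel_leaves_meeting.
Qed.
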